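(* Let $s_1,s_2,s_3$ be the three roots in $y$ of $K(x,y)=y^3-x(1+xy+y^2)(1+y^2+y^4)$ that vanish as $x\to0$, and set $\Delta=1+s_1s_2s_3(s_1+s_2+s_3)$. Then $$\sum_{n\ge0}\sum_{m\ge0}C^{Q}_{R}(n,m)x^ny^m=\frac{-(s_1-y)(s_2-y)(s_3-y)(1-s_1s_2s_3y)}{\Delta\,K(x,y)},$$ $$\sum_{n\ge0}\sum_{m\ge0}C^{Q}(n,m)x^ny^m=\frac{-(s_1-y)(s_2-y)(s_3-y)}{\Delta\,K(x,y)}\Big(1+\tfrac12\big((s_1+s_2)^2+(s_1+s_3)^2+(s_2+s_3)^2\big)$$ $$\qquad+\big(s_1+s_2+s_3+s_1s_2s_3(s_1s_2+s_1s_3+s_2s_3-1)\big)y+\Delta\,y^2\Big),$$ $$\sum_{n\ge0}C^{Q}_{R}(n,0)x^n=\frac{s_1s_2s_3}{x\Delta},\qquad \sum_{n\ge0}C^{Q}(n,0)x^n=\frac{s_1s_2s_3\Big(1+\tfrac12\big((s_1+s_2)^2+(s_1+s_3)^2+(s_2+s_3)^2\big)\Big)}{x\Delta}.$$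
   Context: A lattice path is a finite sequence of steps (vectors in $\mathbb{Z}^2$) starting at $(0,0)$; its vertices are the partial sums, and it terminates at the last vertex (the empty path terminates at $(0,0)$). Let $S_C=\{(1,1),(1,-1),(2,0)\}$ and $S_{CW}=S_C\cup\{(0,2),(0,-2)\}$; $(0,\pm2)$ are vertical steps. A vertically constrained $S_{CW}$ path is a lattice path with steps in $S_{CW}$ with no two consecutive vertical steps. $C^{Q}(n,m)$ is the number of vertically constrained $S_{CW}$ paths from $(0,0)$ to $(n,m)$ all of whose vertices have $y\ge0$, and $C^{Q}_{R}(n,m)$ the number of those whose first step (if any) lies in $S_C$. *)

(* Defs.v *)
From HB Require Import structures.
From mathcomp Require Import all_boot all_order all_algebra fraction finmap.
From mathcomp Require Import boolp classical_sets cardinality.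

Set Implicit Arguments.
Unset Strict Implicit.
Unset Printing Implicit Defensive.

Import Order.TTheory GRing.Theory Num.Theory.

Local Open Scope ring_scope.

(** Formal power series [R[[z]]], represented by their coefficient sequence.
    [{fraction _}] needs an integral domain, so the ring structure is carried
    up to idomainType; equality and inverses are classical. *)

Record fps (R : Type) := Fps { fcoef : nat -> R }.

Notation "{ 'fps' R }" := (fps R) (at level 0, format "{ 'fps'  R }").

Lemma fpsP (R : Type) (f g : {fps R}) :
  (forall n, fcoef f n = fcoef g n) -> f = g.
Proof. by case: f g => [f] [g] /= fg; congr Fps; apply/funext. Qed.

HB.instance Definition _ (R : Type) := gen_eqMixin {fps R}.
HB.instance Definition _ (R : Type) := gen_choiceMixin {fps R}.

Section FpsZmod.
Variable R : zmodType.
Implicit Types f g h : {fps R}.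

Definition fps_zero : {fps R} := Fps (fun _ => 0).
Definition fps_opp f : {fps R} := Fps (fun n => - fcoef f n).
Definition fps_add f g : {fps R} := Fps (fun n => fcoef f n + fcoef g n).

Fact fps_addA : associative fps_add.
Proof. by move=> f g h; apply: fpsP => n; exact: addrA. Qed.

Fact fps_addC : commutative fps_add.
Proof. by move=> f g; apply: fpsP => n; exact: addrC. Qed.

Fact fps_add0 : left_id fps_zero fps_add.
Proof. by move=> f; apply: fpsP => n; exact: add0r. Qed.

Fact fps_addN : left_inverse fps_zero fps_opp fps_add.
Proof. by move=> f; apply: fpsP => n; exact: addNr. Qed.

HB.instance Definition _ :=
  GRing.isZmodule.Build {fps R} fps_addA fps_addC fps_add0 fps_addN.

End FpsZmod.

Section FpsRing.
Variable R : comNzRingType.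
Implicit Types f g h : {fps R}.

Definition fpsC (c : R) : {fps R} := Fps (fun n => c *+ (n == 0%N)).
Definition fpsX : {fps R} := Fps (fun n => (n == 1%N)%:R).

Definition fps_mul f g : {fps R} :=
  Fps (fun n => \sum_(i < n.+1) fcoef f i * fcoef g (n - i)%N).

Definition fps_trunc (n : nat) f : {poly R} := \poly_(i < n.+1) fcoef f i.

Lemma fcoef_mul_trunc n k f g : (k <= n)%N ->
  fcoef (fps_mul f g) k = (fps_trunc n f * fps_trunc n g)`_k.
Proof.
move=> kn; rewrite coefM; apply: eq_bigr => i _; rewrite !coef_poly.
by rewrite !ltnS (leq_trans (leq_ord i) kn) (leq_trans (leq_subr i k) kn).
Qed.

Fact fps_mulC : commutative fps_mul.
Proof.
by move=> f g; apply: fpsP => n; rewrite !(fcoef_mul_trunc _ _ (leqnn n)) mulrC.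
Qed.

Fact fps_mulA : associative fps_mul.
Proof.
move=> f g h; apply: fpsP => n.
transitivity (fps_trunc n f * (fps_trunc n g * fps_trunc n h))`_n.
  rewrite coefM; apply: eq_bigr => i _.
  by rewrite (fcoef_mul_trunc _ _ (leq_subr i n)) coef_poly ltn_ord.
rewrite mulrA coefM; apply: eq_bigr => i _.
by rewrite (fcoef_mul_trunc _ _ (leq_ord i)) [in LHS]coef_poly ltnS leq_subr.
Qed.

Fact fps_mul1 : left_id (fpsC 1) fps_mul.
Proof.
move=> f; apply: fpsP => n /=; rewrite big_ord_recl /= subn0 mul1r big1 ?addr0//.
by move=> i _; rewrite mul0r.
Qed.

Fact fps_mulDl : left_distributive fps_mul +%R.
Proof.
move=> f g h; apply: fpsP => n /=; rewrite -big_split /=.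
by apply: eq_bigr => i _; rewrite mulrDl.
Qed.

Fact fps_oner_neq0 : fpsC 1 != 0.
Proof.
by apply/eqP => /(congr1 (fun f => fcoef f 0)) /eqP; rewrite /= oner_eq0.
Qed.

HB.instance Definition _ := GRing.Zmodule_isComNzRing.Build {fps R}
  fps_mulA fps_mulC fps_mul1 fps_mulDl fps_oner_neq0.

Definition fps_unit : pred {fps R} := fun f => `[< exists g, g * f = 1 >].
Definition fps_inv f : {fps R} := xget f [set g | g * f = 1].

Fact fps_mulVf : {in fps_unit, left_inverse 1 fps_inv *%R}.
Proof. by move=> f /asboolP; exact: (@xgetPex _ f [set g | g * f = 1]). Qed.

Fact fps_unitPl f g : g * f = 1 -> fps_unit f.
Proof. by move=> gf; apply/asboolP; exists g. Qed.

Fact fps_inv_out : {in [predC fps_unit], fps_inv =1 id}.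
Proof.
move=> f /asboolPn nf; apply: xgetPN => g /= gf; by apply: nf; exists g.
Qed.

HB.instance Definition _ := GRing.ComNzRing_hasMulInverse.Build {fps R}
  fps_mulVf fps_unitPl fps_inv_out.

(** [fps_pow N f] is [f(z^N)], for [N > 0]. *)
Definition fps_pow (N : nat) f : {fps R} :=
  Fps (fun k => if (N %| k)%N then fcoef f (k %/ N) else 0).

End FpsRing.

Section FpsIdomain.
Variable R : idomainType.

Lemma fps_order (f : {fps R}) : f != 0 ->
  exists2 n, fcoef f n != 0 & forall k, (k < n)%N -> fcoef f k = 0.
Proof.
move=> f0; have ex : exists n, fcoef f n != 0.
  apply: contrapT => nex; case/eqP: f0; apply: fpsP => n /=.
  by apply/eqP; apply/negPn/negP => fn; apply: nex; exists n.
exists (ex_minn ex); case: ex_minnP => // n fn nmin k kn.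
by apply/eqP; apply: contraTT kn => fk; rewrite -leqNgt nmin.
Qed.

Fact fps_idomain : GRing.integral_domain_axiom {fps R}.
Proof.
move=> f g fg; apply: contraT; rewrite negb_or => /andP[].
move=> /fps_order[m fm fm0] /fps_order[n gn gn0].
have /eqP := congr1 (fun h => fcoef h (m + n)) fg; apply: contraTT => _ /=.
have mlt : (m < (m + n).+1)%N by rewrite ltnS leq_addr.
rewrite (bigD1 (Ordinal mlt)) //= addKn big1 ?addr0 ?mulf_neq0// => i im.
case: (ltngtP i m) => [im'|mi|/eqP].
- by rewrite fm0 ?mul0r.
- rewrite gn0 ?mulr0//; move: (ltn_ord i); rewrite ltnS => ile.
  by rewrite ltn_subLR // ltn_add2r.
- by move=> E; case/eqP: im; apply: val_inj; apply/eqP.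
Qed.

HB.instance Definition _ :=
  GRing.ComUnitRing_isIntegral.Build {fps R} fps_idomain.

End FpsIdomain.

Definition step : choiceType := (int * int)%type.

Definition SC : seq step := [:: (1, 1); (1, -1); (2, 0)].
Definition vertical_steps : seq step := [:: (0, 2); (0, -2)].
Definition SCW : seq step := SC ++ vertical_steps.

Definition vertical (s : step) : bool := s \in vertical_steps.

Definition vertices (p : seq step) : seq step := 0 :: scanl +%R 0 p.
Definition terminus (p : seq step) : step := last 0 (vertices p).

Definition vconstrained (p : seq step) : bool :=
  all (mem SCW) p && sorted (fun s s' => ~~ (vertical s && vertical s')) p.

Definition paths_Q (n m : nat) : set (seq step) :=
  [set p | [/\ vconstrained p, all (fun v => 0 <= v.2) (vertices p)
             & terminus p = (n%:Z, m%:Z)]].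

Definition paths_QR (n m : nat) : set (seq step) :=
  [set p | paths_Q n m p /\ all (mem SC) (take 1 p)].

Lemma terminus_sum p : terminus p = \sum_(s <- p) s.
Proof.
have H a : last a (scanl +%R a p) = a + \sum_(s <- p) s.
  elim: p a => [|s p IHp] a /=; first by rewrite big_nil addr0.
  by rewrite IHp big_cons addrA.
by rewrite /terminus /= H add0r.
Qed.

Lemma size_vconstrained p : vconstrained p ->
  (size p)%:Z <= (terminus p).1 *+ 2 + (vertical (head 0 p))%:Z.
Proof.
rewrite /vconstrained terminus_sum => /andP[].
elim: p => [|s p IHp] /=; first by rewrite big_nil.
case/andP=> sS pS sp; have {IHp} := IHp pS (path_sorted sp).
rewrite big_cons; set S := \sum_(_ <- _) _ => IHp.
have hp : vertical s -> vertical (head 0 p) = false.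
  by move=> vs; case: p sp {pS S IHp} => //= s' p /andP[]; rewrite vs => /negbTE.
have [vs|nvs] := boolP (vertical s).
  rewrite {}hp //= in IHp; have -> : (s + S).1 = S.1 by
    move: vs; rewrite /vertical !inE => /orP[]/eqP->; rewrite /= add0r.
  by rewrite -addn1 PoszD lerD2r -[leRHS]addr0.
have s1 : 1 <= s.1.
  move: sS nvs; rewrite /SCW mem_cat /vertical => /orP[|->//].
  by rewrite !inE => /or3P[]/eqP->.
rewrite /= addr0 mulrnDl -addn1 PoszD addrC.
apply: (le_trans (y := 1 + (S.1 *+ 2 + 1))).
  by rewrite lerD2l (le_trans IHp)// lerD2l; case: vertical.
by rewrite [_ *+ 2 + 1]addrC addrA lerD2r -[1 + 1]/(1 *+ 2) lerMn2r.
Qed.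

Lemma finite_paths_Q n m : finite_set (paths_Q n m).
Proof.
pose L := fix L k : seq (seq step) :=
  if k is k'.+1 then [::] :: [seq s :: q | s <- SCW, q <- L k'] else [:: [::]].
have inL k p : all (mem SCW) p -> (size p <= k)%N -> p \in L k.
  elim: k p => [|k IHk] [|s p] // /andP[sS pS] pk.
  rewrite -[L k.+1]/([::] :: [seq s :: q | s <- SCW, q <- L k]) inE.
  by apply/orP; right; apply: (allpairs_f cons) => //; exact: IHk.
apply: sub_finite_set (finite_seq (L (n.*2.+1))) => p [pv _ pe].
apply: (inL n.*2.+1); first by case/andP: pv.
have := size_vconstrained pv; rewrite pe /= -[_ *+ 2]/(n%:Z + n%:Z) -PoszD.
rewrite -PoszD lez_nat addnn => /leq_trans; apply.
by rewrite -addn1 leq_add2l leq_b1.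
Qed.

(** These sets are finite (see [finite_paths_Q]), so [fset_set] loses nothing. *)
Definition CQ (n m : nat) : nat := #|` fset_set (paths_Q n m)|.
Definition CQR (n m : nat) : nat := #|` fset_set (paths_QR n m)|.

Notation "x %:F" := (FracField.tofrac x) : ring_scope.

Section Series.
Variables (R : comNzRingType) (N : nat).

(** With [t := fpsX R] and [x = t^N], these are [\sum_n c(n) x^n] in [R[[t]]]
    and [\sum_(n, m) c(n, m) x^n y^m] in [R[[t]][[y]]]. *)
Definition gser1 (c : nat -> nat) : {fps R} :=
  fps_pow N (Fps (fun n => (c n)%:R)).
Definition gser2 (c : nat -> nat -> nat) : {fps {fps R}} :=
  Fps (fun m => gser1 (fun n => c n m)).

End Series.

Definition K (A : comNzRingType) (x y : A) : A :=
  y ^+ 3 - x * (1 + x * y + y ^+ 2) * (1 + y ^+ 2 + y ^+ 4).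

(** Puiseux series in [x] with exponents in [(1/N) Z] are Laurent series in
    [t = x^(1/N)]; those that vanish as [x -> 0] are the power series in [t]
    without constant term. *)
Definition vanishing_root (F : comNzRingType) (N : nat) (s : {fps F}) : Prop :=
  K (fpsX F ^+ N) s = 0 /\ fcoef s 0 = 0.

(* Main.v *)
From HB Require Import structures.
Require Import Defs.
From mathcomp Require Import all_boot all_order all_algebra fraction finmap.
From mathcomp Require Import boolp classical_sets cardinality zify ring.

Set Implicit Arguments.
Unset Strict Implicit.
Unset Printing Implicit Defensive.

Import Order.TTheory GRing.Theory Num.Theory.

Local Open Scope classical_set_scope.
Local Open Scope ring_scope.

(** Kernel method. Let [Q] be the series of all paths, with or without the
    restriction on the first step, and [J] the series of those to which a
    vertical step may be appended. Removing the last step expresses [Q] and [J]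
    through each other, and eliminating [J] gives [K(x,y) Q = P(y)] with
    [P(y) = a y^5 - z y^4 + y^3 + p2 y^2 + p1 y - z], where [z = x Q(x,0)] and
    [a] is [0] under the restriction and [1] without it. Since [K(x,y)] vanishes
    at [y = s1, s2, s3], so does [P], which is therefore the product of
    [(y - s1) (y - s2) (y - s3)] and a quadratic polynomial. Comparing the
    coefficients of [y^5], [y^4], [y^3] and [1] determines this quadratic
    polynomial, and [z] with it, although [p1] and [p2] are unknown. *)

Lemma card_fset_set_rcons (T : choiceType) (S : seq T) (A : set (seq T)) :
    uniq S -> finite_set A -> (forall w s, A (rcons w s) -> s \in S) ->
  #|` fset_set A| =
    (([::] \in A) + \sum_(s <- S) #|` fset_set (rcons^~ s @^-1` A)|)%N.
Proof.
elim: S A => [|s S IHS] A /=.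
  move=> _ _ AS; rewrite big_nil addn0.
  have /subset_set1[->|->] : A `<=` [set [::]] by elim/last_ind => // w s _ /AS.
    by rewrite fset_set0 cardfs0 in_set0.
  by rewrite fset_set1 cardfs1 mem_set.
move=> /andP[sS uS] finA AS; rewrite big_cons.
pose B := rcons^~ s @` (rcons^~ s @^-1` A).
have BA : B `<=` A by move=> _ [w Aw <-].
have finB := sub_finite_set BA finA.
have cardB : #|` fset_set B| = #|` fset_set (rcons^~ s @^-1` A)|.
  rewrite fset_set_image ?card_imfset //=; first exact: rcons_injl.
  by apply: finite_preimage finA => w w' _ _; exact: rcons_injl.
rewrite -(cardfsID (fset_set B)) -fset_setI // -fset_setD // (setIidr BA) cardB.
rewrite addnCA; congr (_ + _)%N; rewrite IHS //=; last first.
- move=> w t [Awt nBwt]; move: (AS _ _ Awt); rewrite inE => /orP[/eqP ts|//].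
  by case: nBwt; rewrite ts in Awt *; exists w.
- by apply: sub_finite_set finA => w [].
congr (_ + _)%N.
  congr nat_of_bool; apply/idP/idP; rewrite !inE; first by case.
  by move=> Anil; split=> // -[[|? ?]].
apply: eq_big_seq => t tS; congr #|` fset_set _|; apply/seteqP.
split=> w; first by case.
split=> // -[w' _] /rcons_inj[_ st].
by rewrite st tS in sS.
Qed.

Lemma terminus_rcons p s : terminus (rcons p s) = terminus p + s.
Proof. by rewrite !terminus_sum big_rcons. Qed.

Lemma vertices_rcons p s :
  vertices (rcons p s) = rcons (vertices p) (terminus p + s).
Proof.
rewrite /vertices scanl_rcons rcons_cons -terminus_rcons /terminus /vertices.
by rewrite scanl_rcons /= last_rcons.
Qed.

Lemma vconstrained_rcons p s : vconstrained (rcons p s) =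
  [&& vconstrained p, s \in SCW & ~~ (vertical (last 0 p) && vertical s)].
Proof.
rewrite /vconstrained all_rcons /=; case: p => [|t p] /=.
  by rewrite andbT.
by rewrite rcons_path /= -!andbA; do !bool_congr.
Qed.

Lemma vertical_SC s : s \in SC -> vertical s = false.
Proof. by rewrite !inE => /or3P[]/eqP->. Qed.

Lemma vertical_notin_SC s : vertical s -> s \in SC = false.
Proof. by apply: contraTF => /vertical_SC->. Qed.

Lemma terminus1_ge0 p : vconstrained p -> 0 <= (terminus p).1.
Proof. by move=> /size_vconstrained; rewrite mulr2n; case: vertical; lia. Qed.

Definition paths_to (P : pred (seq step)) (e : step) : set (seq step) :=
  [set p | P p /\ terminus p = e].

Definition npaths (P : pred (seq step)) (e : step) : nat :=
  #|` fset_set (paths_to P e)|.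

Lemma eq_npaths (P P' : pred (seq step)) e :
  (forall p, terminus p = e -> P p = P' p) -> npaths P e = npaths P' e.
Proof.
move=> PP'; congr #|` fset_set _|; apply/seteqP.
by split=> p [Pp pe]; split=> //; rewrite ?PP' // -PP'.
Qed.

Lemma npaths_eq0 (P : pred (seq step)) e :
  (forall p, P p -> terminus p <> e) -> npaths P e = 0%N.
Proof.
move=> Pe; rewrite /npaths (_ : paths_to P e = set0) ?fset_set0 //.
by apply/seteqP; split=> // p [/Pe].
Qed.

Lemma npaths_rcons (P : pred (seq step)) (S : seq step) e :
    uniq S -> finite_set (paths_to P e) ->
    (forall p s, P (rcons p s) -> s \in S) ->
  npaths P e = (P [::] && (e == 0%R) +
    \sum_(s <- S) npaths [pred p | P (rcons p s)] (e - s)%R)%N.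
Proof.
move=> uS finP PS; rewrite /npaths (card_fset_set_rcons uS finP); last first.
  by move=> p s [/PS].
congr (_ + _)%N.
  congr nat_of_bool; apply/idP/idP; rewrite inE /paths_to /=.
    by case=> ->; rewrite /terminus /= => <-; rewrite eqxx.
  by case/andP=> -> /eqP->.
apply: eq_bigr => s _; congr #|` fset_set _|; apply/seteqP; split=> p /=.
  by case=> Pp; rewrite terminus_rcons => <-; split=> //; rewrite addrK.
by case=> Pp pe; split=> //; rewrite terminus_rcons pe subrK.
Qed.

Section Translates.
Implicit Types (s t : step) (S : seq step) (c : step -> nat).

Definition translate s c : step -> nat := fun e => c (e - s).

Definition sum_translates S c : step -> nat :=
  fun e => (\sum_(s <- S) translate s c e)%N.

Lemma translateD s t c : translate s (translate t c) = translate (s + t) c.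
Proof. by apply/funext => e; rewrite /translate opprD addrA. Qed.

Definition vanishes_left c : Prop :=
  forall i j : int, i < 0 -> c (i, j) = 0%N.

Definition vanishes_below c : Prop :=
  forall i j : int, j < 0 -> c (i, j) = 0%N.

Lemma translate_left s c :
  0 <= s.1 -> vanishes_left c -> vanishes_left (translate s c).
Proof.
by move=> s1 c0 i j i0; apply: c0; rewrite ltrBlDr add0r (lt_le_trans i0).
Qed.

Lemma translate_below s c :
  0 <= s.2 -> vanishes_below c -> vanishes_below (translate s c).
Proof.
by move=> s2 c0 i j j0; apply: c0; rewrite ltrBlDr add0r (lt_le_trans j0).
Qed.

End Translates.

Section QuarterPlanePaths.
Variable restricted : bool.

Definition qpath : pred (seq step) := fun p =>
  [&& vconstrained p, all (fun v => 0 <= v.2) (vertices p)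
    & restricted ==> all (mem SC) (take 1 p)].

Definition vertically_extendable : pred (seq step) := fun p =>
  [&& qpath p, ~~ vertical (last 0 p) & restricted ==> (p != [::])].

Lemma qpath_vconstrained p : qpath p -> vconstrained p.
Proof. by case/and3P. Qed.

Lemma vertically_extendable_qpath p : vertically_extendable p -> qpath p.
Proof. by case/and3P. Qed.

Lemma qpath_nil : qpath [::].
Proof. by rewrite /qpath /= implybT. Qed.

Lemma vertically_extendable_nil : vertically_extendable [::] = ~~ restricted.
Proof. by rewrite /vertically_extendable qpath_nil implybF. Qed.

Lemma qpath_terminus_ge0 p :
  qpath p -> 0 <= (terminus p).1 /\ 0 <= (terminus p).2.
Proof.
case/and3P=> vp /allP p_ge0 _; split; first exact: terminus1_ge0.
by apply: p_ge0; rewrite /terminus /vertices /= mem_last.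
Qed.

Lemma finite_qpath e : finite_set (paths_to qpath e).
Proof.
case: e => [[n|n] [m|m]].
- by apply: sub_finite_set (finite_paths_Q n m) => p [/and3P[]].
all: apply: sub_finite_set (finite_set0 _) => p [/qpath_terminus_ge0[]].
all: by move=> x_ge0 y_ge0 pe; rewrite pe in x_ge0 y_ge0.
Qed.

Lemma qpath_rcons_SC p s : s \in SC ->
  qpath (rcons p s) = qpath p && (0 <= (terminus p + s).2).
Proof.
move=> sS; rewrite /qpath vconstrained_rcons vertices_rcons all_rcons.
have -> : s \in SCW by rewrite mem_cat sS.
have -> : all (mem SC) (take 1 (rcons p s)) = all (mem SC) (take 1 p).
  by case: p => [|t p] /=; rewrite ?take0 // andbT; exact: sS.
by rewrite (vertical_SC sS) andbF /= andbT -!andbA; do !bool_congr.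
Qed.

Lemma qpath_rcons_vertical p s : vertical s ->
  qpath (rcons p s) = vertically_extendable p && (0 <= (terminus p + s).2).
Proof.
move=> vs; rewrite /vertically_extendable /qpath.
rewrite vconstrained_rcons vertices_rcons.
have -> : s \in SCW by rewrite mem_cat orbC [_ \in _]vs.
have -> : restricted ==> all (mem SC) (take 1 (rcons p s)) =
    (restricted ==> all (mem SC) (take 1 p)) && (restricted ==> (p != [::])).
  case: p restricted => [|t p] [] //=; last by rewrite !take0 andbT.
  by rewrite andbT; exact: vertical_notin_SC.
by rewrite all_rcons vs /= andbT -!andbA; do !bool_congr.
Qed.

Lemma vertically_extendable_rcons p s :
  vertically_extendable (rcons p s) = (s \in SC) && qpath (rcons p s).
Proof.
have nnil : rcons p s != [::] by case: p.
rewrite /vertically_extendable last_rcons nnil implybT andbT.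
have [sS|nS] := boolP (s \in SC); first by rewrite (vertical_SC sS) andbT.
apply: contraNF nS => /andP[/qpath_vconstrained].
by rewrite vconstrained_rcons mem_cat => /and3P[_ /orP[//|vs _ /negP[]]].
Qed.

Definition nqpath : step -> nat := npaths qpath.
Definition nextendable : step -> nat := npaths vertically_extendable.

Lemma nqpath_rec e : 0 <= e.2 ->
  nqpath e = ((e == 0%R) + sum_translates SC nqpath e +
    sum_translates vertical_steps nextendable e)%N.
Proof.
move=> e2; rewrite /nqpath (@npaths_rcons _ SCW) //; first last.
- by move=> p s /qpath_vconstrained; rewrite vconstrained_rcons => /and3P[].
- exact: finite_qpath.
rewrite qpath_nil big_cat addnA /=; congr (_ + _ + _)%N.
all: apply: eq_big_seq => s sS; apply: eq_npaths => p pe /=.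
  by rewrite qpath_rcons_SC // pe subrK e2 andbT.
by rewrite qpath_rcons_vertical // pe subrK e2 andbT.
Qed.

Lemma nextendable_rec e : 0 <= e.2 ->
  nextendable e =
    (~~ restricted && (e == 0%R) + sum_translates SC nqpath e)%N.
Proof.
move=> e2; rewrite /nextendable (@npaths_rcons _ SC) //; first last.
- by move=> p s; rewrite vertically_extendable_rcons => /andP[].
- apply: sub_finite_set (finite_qpath e) => p [pv pe].
  by split=> //; exact: vertically_extendable_qpath.
rewrite vertically_extendable_nil; congr (_ + _)%N.
apply: eq_big_seq => s sS; apply: eq_npaths => p pe /=.
by rewrite vertically_extendable_rcons sS qpath_rcons_SC // pe subrK e2 andbT.
Qed.

Lemma nqpath_left : vanishes_left nqpath.
Proof.
move=> i j i_lt0; apply: npaths_eq0 => p /qpath_terminus_ge0[x_ge0 _] pe.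
by move: x_ge0; rewrite pe leNgt i_lt0.
Qed.

Lemma nqpath_below : vanishes_below nqpath.
Proof.
move=> i j j_lt0; apply: npaths_eq0 => p /qpath_terminus_ge0[_ y_ge0] pe.
by move: y_ge0; rewrite pe leNgt j_lt0.
Qed.

Lemma nextendable_below : vanishes_below nextendable.
Proof.
move=> i j j_lt0; apply: npaths_eq0 => p /vertically_extendable_qpath.
by move=> /qpath_terminus_ge0[_ y_ge0] pe; move: y_ge0; rewrite pe leNgt j_lt0.
Qed.

End QuarterPlanePaths.

Lemma CQE : CQ = fun n m => nqpath false (n%:Z, m%:Z).
Proof.
apply/funext => n; apply/funext => m; congr #|` fset_set _|; apply/seteqP.
split=> p; first by move=> [vp p_ge0 pe]; split=> //; rewrite /qpath vp p_ge0.
by move=> [/and3P[vp p_ge0 _] pe].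
Qed.

Lemma CQRE : CQR = fun n m => nqpath true (n%:Z, m%:Z).
Proof.
apply/funext => n; apply/funext => m; congr #|` fset_set _|; apply/seteqP.
split=> p; last by move=> [/and3P[vp p_ge0 p_SC] pe]; split.
by move=> [[vp p_ge0 pe] p_SC]; split=> //; rewrite /qpath vp p_ge0.
Qed.

Section FpsCoefficients.
Variable R : comNzRingType.
Implicit Types (a : R) (f g : {fps R}) (p : {poly R}).

Lemma fcoefD f g n : fcoef (f + g) n = fcoef f n + fcoef g n.
Proof. by []. Qed.

Lemma fcoefB f g n : fcoef (f - g) n = fcoef f n - fcoef g n.
Proof. by []. Qed.

Lemma fcoefM f g n :
  fcoef (f * g) n = \sum_(i < n.+1) fcoef f i * fcoef g (n - i)%N.
Proof. by []. Qed.

Lemma fcoefM0 f g : fcoef (f * g) 0 = fcoef f 0 * fcoef g 0.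
Proof. by rewrite fcoefM big_ord1. Qed.

Lemma fcoefCM a f n : fcoef (fpsC a * f) n = a * fcoef f n.
Proof.
rewrite fcoefM big_ord_recl /= subn0 big1 ?addr0 //.
by move=> i _; rewrite mulr0n mul0r.
Qed.

Lemma fcoefXM f n : fcoef (fpsX R * f) n = if n is k.+1 then fcoef f k else 0.
Proof.
rewrite fcoefM big_ord_recl /= mul0r add0r; case: n => [|n].
  by rewrite big_ord0.
rewrite big_ord_recl /= mul1r subSS subn0 big1 ?addr0 //.
by move=> i _; rewrite mul0r.
Qed.

Lemma fcoefXnM k f n :
  fcoef (fpsX R ^+ k * f) n = if (k <= n)%N then fcoef f (n - k) else 0.
Proof.
elim: k n => [|k IHk] n; first by rewrite expr0 mul1r subn0.
by rewrite exprS -mulrA fcoefXM; case: n => // n; rewrite IHk.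
Qed.

Lemma fpsX_dvd f : fcoef f 0 = 0 -> exists g, f = fpsX R * g.
Proof.
move=> f0; exists (Fps (fun n => fcoef f n.+1)).
by apply: fpsP => -[|n]; rewrite fcoefXM.
Qed.

Lemma fpsXn_dvd_eq0 f : (forall n, exists g, f = fpsX R ^+ n * g) -> f = 0.
Proof.
move=> fX; apply: fpsP => n; have [g ->] := fX n.+1.
by rewrite fcoefXnM ltnn.
Qed.

Definition fps_poly p : {fps R} := Fps (nth 0 p).

Fact fps_poly_is_zmod_morphism : zmod_morphism fps_poly.
Proof. by move=> p q; apply: fpsP => n /=; rewrite coefB. Qed.

Fact fps_poly_is_monoid_morphism : monoid_morphism fps_poly.
Proof.
split=> [|p q]; apply: fpsP => n /=; last by rewrite coefM.
by rewrite coef1; case: eqP.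
Qed.

HB.instance Definition _ :=
  GRing.isZmodMorphism.Build {poly R} {fps R} fps_poly
    fps_poly_is_zmod_morphism.
HB.instance Definition _ :=
  GRing.isMonoidMorphism.Build {poly R} {fps R} fps_poly
    fps_poly_is_monoid_morphism.

Lemma fps_polyC a : fps_poly a%:P = fpsC a.
Proof. by apply: fpsP => n /=; rewrite coefC; case: eqP. Qed.

Lemma fps_polyX : fps_poly 'X = fpsX R.
Proof. by apply: fpsP => n /=; rewrite coefX. Qed.

Fact fpsC_is_zmod_morphism : zmod_morphism (@fpsC R).
Proof. by move=> a b; rewrite -!fps_polyC polyCB rmorphB. Qed.

Fact fpsC_is_monoid_morphism : monoid_morphism (@fpsC R).
Proof. by split=> // a b; rewrite -!fps_polyC polyCM rmorphM. Qed.

HB.instance Definition _ :=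
  GRing.isZmodMorphism.Build R {fps R} (@fpsC R) fpsC_is_zmod_morphism.
HB.instance Definition _ :=
  GRing.isMonoidMorphism.Build R {fps R} (@fpsC R) fpsC_is_monoid_morphism.

Lemma fpsC_inj : injective (@fpsC R).
Proof. by move=> a b /(congr1 (fun f => fcoef f 0)). Qed.

Lemma fpsC_eq0 a : (fpsC a == 0) = (a == 0).
Proof. by rewrite -(inj_eq fpsC_inj) rmorph0. Qed.

Lemma fpsX_neq0 : fpsX R != 0.
Proof.
by apply/eqP => /(congr1 (fun f => fcoef f 1))/eqP; rewrite /= oner_eq0.
Qed.

End FpsCoefficients.

(* Comparing coefficients gives [c = - s ^+ n.+1 * fcoef g n] for all [n]; this
   replaces the substitution of [s] for the variable, which is not defined. *)
Lemma fps_XsubC_mul_const (R : comNzRingType) (s c : {fps R})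
    (g : {fps {fps R}}) :
  fcoef s 0 = 0 -> (fpsX {fps R} - fpsC s) * g = fpsC c -> c = 0.
Proof.
move=> /fpsX_dvd[s' sE] gE; apply: fpsXn_dvd_eq0 => n.
have g_coef k : fcoef (fpsX {fps R} * g) k - s * fcoef g k = c *+ (k == 0%N).
  by rewrite -fcoefCM -fcoefB -mulrBl gE.
have g_rec k : fcoef g k = s * fcoef g k.+1.
  by have /eqP := g_coef k.+1; rewrite fcoefXM subr_eq0 => /eqP.
have g0E : fcoef g 0 = s ^+ n * fcoef g n.
  elim: n => [|k IHk]; first by rewrite expr0 mul1r.
  by rewrite IHk g_rec exprSr mulrA.
have := g_coef 0%N; rewrite fcoefXM sub0r mulr1n g0E => <-.
exists (- (s' ^+ n * (s * fcoef g n))).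
by rewrite mulrN mulrCA (mulrA (fpsX R ^+ n)) -exprMn -sE.
Qed.

Lemma kernel_method (R : comNzRingType) (s : {fps R}) (p q : {poly {fps R}})
    (f : {fps {fps R}}) :
    fcoef s 0 = 0 -> fps_poly p * f = fps_poly q -> root p s ->
  root q s.
Proof.
move=> s0 pq /factor_theorem[p' pE].
have /factor_theorem[q' qE] : root (q - q.[s]%:P) s.
  by rewrite /root !hornerE subrr.
apply/eqP; apply: (fps_XsubC_mul_const (g := fps_poly p' * f - fps_poly q') s0).
have XsubC_mul r : (fpsX {fps R} - fpsC s) * fps_poly r =
    fps_poly (r * ('X - s%:P)).
  by rewrite rmorphM rmorphB /= fps_polyX fps_polyC mulrC.
by rewrite mulrBr mulrA !XsubC_mul -pE -qE pq rmorphB /= subKr fps_polyC.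
Qed.

Section QuadrantGeneratingFunctions.
Variables (R : comNzRingType) (N : nat).
Hypothesis N_gt0 : (0 < N)%N.
Implicit Type c : step -> nat.

Local Notation x := (fpsC (fpsX R ^+ N)).
Local Notation y := (fpsX {fps R}).

Definition row_gf c (m : nat) : {fps R} := gser1 R N (fun n => c (n%:Z, m%:Z)).

Definition quadrant_gf c : {fps {fps R}} := Fps (row_gf c).

Lemma fcoef_row_gf c m k :
  fcoef (row_gf c m) k =
    if (N %| k)%N then (c ((k %/ N)%N%:Z, m%:Z))%:R else 0.
Proof. by []. Qed.

Lemma eq_quadrant_gf c c' : (forall e, 0 <= e.2 -> c e = c' e) ->
  quadrant_gf c = quadrant_gf c'.
Proof.
by move=> cc'; apply: fpsP => m; apply: fpsP => k; rewrite !fcoef_row_gf cc'.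
Qed.

Lemma quadrant_gfD c c' :
  quadrant_gf (fun e => c e + c' e)%N = quadrant_gf c + quadrant_gf c'.
Proof.
apply: fpsP => m; apply: fpsP => k; rewrite !(fcoefD, fcoef_row_gf).
by case: ifP; rewrite ?addr0 // natrD.
Qed.

Lemma quadrant_gf_origin (b : bool) :
  quadrant_gf (fun e => b && (e == 0%R)) = b%:R.
Proof.
have -> : b%:R = fpsC (fpsC b%:R) :> {fps {fps R}} by rewrite !rmorph_nat.
have originE n m : ((n%:Z, m%:Z) == 0 :> step) = (n == 0%N) && (m == 0%N).
  by [].
apply: fpsP => -[|m]; apply: fpsP => k; rewrite fcoef_row_gf originE /=.
  case: k => [|k]; first by rewrite dvdn0 div0n andbT.
  rewrite mulr0n; case: ifP => // /dvdnP[[//|n] ->].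
  by rewrite mulnK // andbF.
by rewrite !andbF if_same.
Qed.

Lemma quadrant_gf_sum (I : Type) (r : seq I) (c : I -> step -> nat) :
  quadrant_gf (fun e => \sum_(i <- r) c i e)%N =
    \sum_(i <- r) quadrant_gf (c i).
Proof.
elim: r => [|i r IHr].
  rewrite big_nil -[RHS](quadrant_gf_origin false).
  by apply: eq_quadrant_gf => e _; rewrite big_nil.
rewrite big_cons -IHr -quadrant_gfD.
by apply: eq_quadrant_gf => e _; rewrite big_cons.
Qed.

Lemma quadrant_gf_right c : vanishes_left c ->
  quadrant_gf (translate (1, 0) c) = x * quadrant_gf c.
Proof.
move=> c0; apply: fpsP => m; rewrite fcoefCM; apply: fpsP => k.
rewrite fcoefXnM !fcoef_row_gf /translate; case: leqP => Nk; last first.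
  by rewrite divn_small // c0 // if_same.
rewrite -{1 2}(subnK Nk) dvdn_addl // divnDr // divnn N_gt0 PoszD.
by rewrite -[_ - (1, 0)]/(_ + 1 - 1, m%:Z - 0) addrK subr0.
Qed.

Lemma quadrant_gf_up c : vanishes_below c ->
  quadrant_gf (translate (0, 1) c) = y * quadrant_gf c.
Proof.
move=> c0; apply: fpsP => -[|m]; rewrite fcoefXM; apply: fpsP => k.
  by rewrite fcoef_row_gf /translate c0 // if_same.
rewrite !fcoef_row_gf /translate -addn1 PoszD.
by rewrite -[_ - (0, 1)]/(_ - 0, m%:Z + 1 - 1) addrK subr0.
Qed.

Lemma row_gf_down c m : row_gf (translate (0, -1) c) m = row_gf c m.+1.
Proof.
apply: fpsP => k; rewrite !fcoef_row_gf /translate.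
by rewrite -[_ - (0, -1)]/(_ - 0, (m + 1)%N%:Z) subr0 addn1.
Qed.

Lemma quadrant_gf_down c :
  y * quadrant_gf (translate (0, -1) c) = quadrant_gf c - fpsC (row_gf c 0).
Proof.
apply: fpsP => -[|m]; rewrite fcoefB fcoefXM; first by rewrite subrr.
by rewrite [RHS]subr0; exact: row_gf_down.
Qed.

Variable c : step -> nat.
Hypothesis c_left : vanishes_left c.
Hypothesis c_below : vanishes_below c.

Lemma quadrant_gf_SC :
  y * quadrant_gf (sum_translates SC c) =
    x * ((1 + x * y + y ^+ 2) * quadrant_gf c) - x * fpsC (row_gf c 0).
Proof.
rewrite (quadrant_gf_sum SC (translate^~ c)) !big_cons big_nil addr0 !mulrDr.
have -> : quadrant_gf (translate (1, 1) c) = x * (y * quadrant_gf c).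
  rewrite -[(1, 1)]/((1, 0) + (0, 1) : step) -translateD quadrant_gf_right.
    by rewrite quadrant_gf_up.
  exact: translate_left.
have -> : y * quadrant_gf (translate (1, -1) c) =
    x * (quadrant_gf c - fpsC (row_gf c 0)).
  rewrite -[(1, -1)]/((1, 0) + (0, -1) : step) -translateD quadrant_gf_right.
    by rewrite mulrCA quadrant_gf_down.
  exact: translate_left.
have -> : quadrant_gf (translate (2, 0) c) = x * (x * quadrant_gf c).
  rewrite -[(2, 0)]/((1, 0) + (1, 0) : step) -translateD quadrant_gf_right.
    by rewrite quadrant_gf_right.
  exact: translate_left.
ring.
Qed.

Lemma quadrant_gf_vertical :
  y ^+ 2 * quadrant_gf (sum_translates vertical_steps c) =
    (1 + y ^+ 4) * quadrant_gf c - fpsC (row_gf c 0) - fpsC (row_gf c 1) * y.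
Proof.
rewrite (quadrant_gf_sum _ (translate^~ c)) !big_cons big_nil addr0 mulrDr.
have -> : quadrant_gf (translate (0, 2) c) = y * (y * quadrant_gf c).
  rewrite -[(0, 2)]/((0, 1) + (0, 1) : step) -translateD quadrant_gf_up.
    by rewrite quadrant_gf_up.
  exact: translate_below.
have -> : y ^+ 2 * quadrant_gf (translate (0, -2) c) =
    quadrant_gf c - fpsC (row_gf c 0) - y * fpsC (row_gf c 1).
  rewrite -[(0, -2)]/((0, -1) + (0, -1) : step) -translateD expr2 -mulrA.
  by rewrite quadrant_gf_down mulrBr quadrant_gf_down row_gf_down.
ring.
Qed.

End QuadrantGeneratingFunctions.

Lemma rmorph_K (A B : comNzRingType) (f : {rmorphism A -> B}) x y :
  f (K x y) = K (f x) (f y).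
Proof. by rewrite /K !(rmorphB, rmorphM, rmorphD, rmorphXn, rmorph1). Qed.

Lemma horner_K (A : comNzRingType) (x s : A) : (K x%:P 'X).[s] = K x s.
Proof. by rewrite -horner_evalE rmorph_K /= !horner_evalE hornerC hornerX. Qed.

Lemma fps_poly_K (R : comNzRingType) (x : R) :
  fps_poly (K x%:P 'X) = K (fpsC x) (fpsX R).
Proof. by rewrite rmorph_K /= fps_polyC fps_polyX. Qed.

Section KernelEquation.
Variables (R : comNzRingType) (N : nat) (restricted : bool).
Hypothesis N_gt0 : (0 < N)%N.

Local Notation x := (fpsC (fpsX R ^+ N)).
Local Notation y := (fpsX {fps R}).
Local Notation gf := (quadrant_gf R N).
Local Notation q := (nqpath restricted).
Local Notation j := (nextendable restricted).

Definition kernel_numerator : {poly {fps R}} :=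
  let a := (~~ restricted)%:R in
  let z := fpsX R ^+ N * row_gf R N q 0 in
  Poly [:: - z; a - row_gf R N j 0; - (z + row_gf R N j 1); 1; - z; a].

Lemma quadrant_gf_nqpath :
  gf q = 1 + gf (sum_translates SC q) + gf (sum_translates vertical_steps j).
Proof.
rewrite -[1](quadrant_gf_origin _ N_gt0 true) -!quadrant_gfD.
exact/eq_quadrant_gf/nqpath_rec.
Qed.

Lemma quadrant_gf_nextendable :
  gf j = (~~ restricted)%:R + gf (sum_translates SC q).
Proof.
rewrite -(quadrant_gf_origin _ N_gt0) -quadrant_gfD.
exact/eq_quadrant_gf/nextendable_rec.
Qed.

Lemma kernel_equation :
  fps_poly (K (fpsX R ^+ N)%:P 'X) * gf q = fps_poly kernel_numerator.
Proof.
set gfSC := gf (sum_translates SC q).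
set gfV := gf (sum_translates vertical_steps j).
have gfSC_E :
    y * gfSC + x * fpsC (row_gf R N q 0) = x * (1 + x * y + y ^+ 2) * gf q.
  rewrite [y * gfSC]quadrant_gf_SC ?subrK ?mulrA //; first exact: nqpath_left.
  exact: nqpath_below.
have gfV_E : y ^+ 2 * gfV = (1 + y ^+ 4) * gf j
    - fpsC (row_gf R N j 0) - fpsC (row_gf R N j 1) * y.
  by apply: quadrant_gf_vertical => //; exact: nextendable_below.
have -> : fps_poly (K (fpsX R ^+ N)%:P 'X) * gf q =
    y ^+ 3 * (1 + gfSC) + y * (y ^+ 2 * gfV)
    - (1 + y ^+ 2 + y ^+ 4) * (y * gfSC + x * fpsC (row_gf R N q 0)).
  rewrite gfSC_E fps_poly_K /K mulrBl {1}quadrant_gf_nqpath -/gfSC -/gfV.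
  by ring.
rewrite gfV_E quadrant_gf_nextendable -/gfSC.
rewrite /kernel_numerator /= !cons_poly_def.
rewrite !(rmorphD, rmorphM) /= !fps_polyC fps_polyX rmorph0.
rewrite !(rmorphB, rmorphN, rmorphD, rmorphM, rmorph1) /= !rmorph_nat.
by ring.
Qed.

End KernelEquation.

Section CubicFactor.
Variables (R : comNzRingType) (r1 r2 r3 : R).

Local Notation cubic := (\prod_(r <- [:: r1; r2; r3]) ('X - r%:P)).

Lemma prod_XsubC3 : cubic =
  'X^3 - (r1 + r2 + r3)%:P * 'X^2 + (r1 * r2 + r1 * r3 + r2 * r3)%:P * 'X
  - (r1 * r2 * r3)%:P.
Proof. by rewrite !big_cons big_nil !(polyCD, polyCM); ring. Qed.

Lemma coef0M_prod_XsubC3 q : (q * cubic)`_0 = - (r1 * r2 * r3 * q`_0).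
Proof.
rewrite prod_XsubC3 coef0M.
by rewrite !(coefB, coefD, coefXn, coefCM, coefX, coefC) /=; ring.
Qed.

Lemma coefM_prod_XsubC3 q k : (q * cubic)`_k.+3 =
  q`_k - (r1 + r2 + r3) * q`_k.+1 + (r1 * r2 + r1 * r3 + r2 * r3) * q`_k.+2
  - r1 * r2 * r3 * q`_k.+3.
Proof.
rewrite prod_XsubC3 mulrBr mulrDr mulrBr !(mulrCA q _%:P) (mulrC q _%:P).
rewrite coefB coefD coefB !coefCM !(coefMXn, coefMX) /=.
by rewrite !subSS !subn0.
Qed.

End CubicFactor.

Definition Delta_of (A : pzRingType) (r1 r2 r3 : A) : A :=
  1 + r1 * r2 * r3 * (r1 + r2 + r3).

Lemma rmorph_Delta (A B : pzRingType) (f : {rmorphism A -> B}) r1 r2 r3 :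
  f (Delta_of r1 r2 r3) = Delta_of (f r1) (f r2) (f r3).
Proof. by rewrite !(rmorphD, rmorphM, rmorph1). Qed.

Section ThreeRoots.
Variables (L : fieldType) (r1 r2 r3 : L).

Local Notation e1 := (r1 + r2 + r3).
Local Notation e2 := (r1 * r2 + r1 * r3 + r2 * r3).
Local Notation e3 := (r1 * r2 * r3).

Definition cofactor0 (a : L) : L :=
  (1 + a * (e1 ^+ 2 - e2)) / Delta_of r1 r2 r3.

Definition cofactor (a y : L) : L :=
  cofactor0 a + (a * e1 - e3 * cofactor0 a) * y + a * y ^+ 2.

Lemma quintic_three_roots (p : {poly L}) :
    (size p <= 6)%N -> p`_3 = 1 -> p`_4 = p`_0 ->
    uniq [:: r1; r2; r3] -> all (root p) [:: r1; r2; r3] ->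
    Delta_of r1 r2 r3 != 0 ->
  p`_0 = - (e3 * cofactor0 p`_5) /\
  forall y, p.[y] = (y - r1) * (y - r2) * (y - r3) * cofactor p`_5 y.
Proof.
move=> p_size p3 p4 r_uniq p_roots Delta0.
have [|q pE] := uniq_roots_prod_XsubC p_roots; first by rewrite uniq_rootsE.
have q_size : (size q <= 3)%N.
  have [->|q0] := eqVneq q 0; first by rewrite size_poly0.
  move: p_size; rewrite pE size_Mmonic ?monic_prod_XsubC // size_prod_XsubC.
  by rewrite addn4.
have p_coef k := coefM_prod_XsubC3 r1 r2 r3 q k; rewrite -pE in p_coef.
have q_coef k : q`_k.+3 = 0 by rewrite nth_default // (leq_trans q_size).
have q2E : q`_2 = p`_5 by rewrite p_coef !q_coef !(mulr0, subr0, addr0).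
have q1E : q`_1 = p`_0 + e1 * p`_5.
  by rewrite -p4 p_coef !q_coef q2E; ring.
have p0E : p`_0 = - (e3 * q`_0) by rewrite pE coef0M_prod_XsubC3.
have q0E : q`_0 = cofactor0 p`_5.
  have p3E : 1 = q`_0 - e1 * q`_1 + e2 * q`_2.
    by rewrite -p3 p_coef q_coef mulr0 subr0.
  rewrite /cofactor0 {1}p3E q2E q1E p0E.
  by move: Delta0; rewrite /Delta_of => Delta0; field.
split=> [|y]; first by rewrite -q0E.
rewrite {1}pE hornerM horner_prod !big_cons big_nil !hornerXsubC.
rewrite (horner_coef_wide _ q_size) !big_ord_recr big_ord0 /= q2E q1E p0E q0E.
by rewrite /cofactor; ring.
Qed.

Hypothesis Delta_neq0 : Delta_of r1 r2 r3 != 0.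

Lemma restricted_gfE (k y f : L) : k != 0 ->
    k * f = (y - r1) * (y - r2) * (y - r3) * cofactor 0 y ->
  f = - (r1 - y) * (r2 - y) * (r3 - y) * (1 - e3 * y) / (Delta_of r1 r2 r3 * k).
Proof.
move=> k0 fE; apply: (mulfI k0); rewrite fE /cofactor /cofactor0.
by field; apply/andP.
Qed.

Lemma restricted_rowE (x f : L) : x != 0 ->
  x * f = e3 * cofactor0 0 -> f = e3 / (x * Delta_of r1 r2 r3).
Proof.
move=> x0 fE; apply: (mulfI x0); rewrite fE /cofactor0.
by field; apply/andP.
Qed.

Hypothesis two_neq0 : 2 != 0 :> L.

Lemma unrestricted_gfE (k y f : L) : k != 0 ->
    k * f = (y - r1) * (y - r2) * (y - r3) * cofactor 1 y ->
  f = - (r1 - y) * (r2 - y) * (r3 - y) / (Delta_of r1 r2 r3 * k)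
      * (1 + 2^-1 * ((r1 + r2) ^+ 2 + (r1 + r3) ^+ 2 + (r2 + r3) ^+ 2)
         + (e1 + e3 * (e2 - 1)) * y + Delta_of r1 r2 r3 * y ^+ 2).
Proof.
move=> k0 fE; apply: (mulfI k0); rewrite fE /cofactor /cofactor0.
by move: Delta_neq0; rewrite /Delta_of => Delta0; field; apply/and3P.
Qed.

Lemma unrestricted_rowE (x f : L) : x != 0 ->
    x * f = e3 * cofactor0 1 ->
  f = e3 * (1 + 2^-1 * ((r1 + r2) ^+ 2 + (r1 + r3) ^+ 2 + (r2 + r3) ^+ 2))
      / (x * Delta_of r1 r2 r3).
Proof.
move=> x0 fE; apply: (mulfI x0); rewrite fE /cofactor0.
by field; apply/and3P.
Qed.

End ThreeRoots.

Definition fracC (R : idomainType) : {rmorphism R -> {fraction {fps R}}} :=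
  @FracField.tofrac {fps R} \o @fpsC R.

Lemma fracC_eq0 (R : idomainType) (a : R) : (fracC R a == 0) = (a == 0).
Proof. by rewrite /= tofrac_eq0 fpsC_eq0. Qed.

Lemma fracC_inj (R : idomainType) : injective (fracC R).
Proof.
by apply: raddf_inj => a /eqP; rewrite fracC_eq0 => /eqP.
Qed.

Lemma horner_fracC (R : idomainType) (p : {poly R}) :
  (map_poly (fracC R) p).[(fpsX R)%:F] = (fps_poly p)%:F.
Proof.
elim/poly_ind: p => [|p a IHp]; first by rewrite !rmorph0 horner0.
rewrite rmorphD rmorphM /= map_polyX map_polyC hornerD hornerMX hornerC IHp.
by rewrite [in RHS]rmorphD rmorphM /= rmorphD rmorphM /= fps_polyX fps_polyC.
Qed.

Section NonzeroDenominators.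
Variables (R : idomainType) (N : nat).

Lemma K_fracC_neq0 : K (fracC _ (fpsX R ^+ N)) (fpsX {fps R})%:F != 0.
Proof.
rewrite -[X in K X _]/((fpsC _)%:F) -rmorph_K tofrac_eq0 -fps_poly_K.
apply/eqP => /(congr1 (fun f => fcoef f 0)) /= /eqP.
rewrite -horner_coef0 horner_K /K !expr0n /= mulr0 !addr0 !mulr1 sub0r.
by rewrite oppr_eq0 expf_eq0 (negbTE (fpsX_neq0 R)) andbF.
Qed.

Lemma Delta_fracC_neq0 (s1 s2 s3 : {fps R}) : fcoef s1 0 = 0 ->
  Delta_of (fracC _ s1) (fracC _ s2) (fracC _ s3) != 0.
Proof.
move=> s10; rewrite -rmorph_Delta fracC_eq0.
apply/eqP => /(congr1 (fun f => fcoef f 0)) /eqP.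
by rewrite fcoefD !fcoefM0 s10 !mul0r addr0 oner_eq0.
Qed.

End NonzeroDenominators.

Section QuarterPlaneSeries.
Variables (F : fieldType) (N : nat) (s1 s2 s3 : {fps F}).
Hypothesis N_gt0 : (0 < N)%N.
Hypothesis s_uniq : uniq [:: s1; s2; s3].
Hypothesis s1_root : vanishing_root N s1.
Hypothesis s2_root : vanishing_root N s2.
Hypothesis s3_root : vanishing_root N s3.

Local Notation x := (fracC _ (fpsX F ^+ N)).
Local Notation y := ((fpsX {fps F})%:F).
Local Notation r1 := (fracC _ s1).
Local Notation r2 := (fracC _ s2).
Local Notation r3 := (fracC _ s3).

Lemma kernel_numerator_root restricted s : vanishing_root N s ->
  root (kernel_numerator F N restricted) s.
Proof.
case=> Ks s0; apply: kernel_method s0 (kernel_equation F restricted N_gt0) _.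
by rewrite /root horner_K Ks.
Qed.

Lemma nqpath_series (restricted : bool) :
  x * fracC _ (row_gf F N (nqpath restricted) 0) =
    r1 * r2 * r3 * cofactor0 r1 r2 r3 (~~ restricted)%:R /\
  K x y * (quadrant_gf F N (nqpath restricted))%:F =
    (y - r1) * (y - r2) * (y - r3) * cofactor r1 r2 r3 (~~ restricted)%:R y.
Proof.
pose p := map_poly (fracC _) (kernel_numerator F N restricted).
have p_coef k : p`_k = fracC _ (kernel_numerator F N restricted)`_k.
  by rewrite coef_map.
have p_size : (size p <= 6)%N.
  by rewrite (leq_trans (size_poly _ _)) // (leq_trans (size_Poly _)).
have r_uniq : uniq [:: r1; r2; r3].
  by have := s_uniq; rewrite -(map_inj_uniq (@fracC_inj _)).
have p_roots : all (root p) [:: r1; r2; r3].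
  by rewrite /= !rmorph_root ?kernel_numerator_root.
have [||p0E pE] := quintic_three_roots p_size _ _ r_uniq p_roots
  (Delta_fracC_neq0 s2 s3 s1_root.2).
- by rewrite p_coef coef_Poly rmorph1.
- by rewrite !p_coef !coef_Poly.
have p5 : p`_5 = (~~ restricted)%:R by rewrite p_coef coef_Poly rmorph_nat.
rewrite -p5; split.
  by rewrite -[RHS]opprK -p0E p_coef coef_Poly rmorphN opprK rmorphM.
rewrite -[RHS]pE horner_fracC -(kernel_equation F restricted N_gt0) fps_poly_K.
by rewrite rmorphM /= rmorph_K.
Qed.

End QuarterPlaneSeries.

Theorem theorem24 (F : numClosedFieldType) (N : nat) (s1 s2 s3 : {fps F}) :
  (0 < N)%N ->
  uniq [:: s1; s2; s3] ->
  vanishing_root N s1 -> vanishing_root N s2 -> vanishing_root N s3 ->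
  let inj (a : {fps F}) : {fraction {fps {fps F}}} := (fpsC a)%:F in
  let x := inj (fpsX F ^+ N) in
  let y : {fraction {fps {fps F}}} := (fpsX {fps F})%:F in
  let r1 := inj s1 in
  let r2 := inj s2 in
  let r3 := inj s3 in
  let Delta := 1 + r1 * r2 * r3 * (r1 + r2 + r3) in
  [/\ (gser2 F N CQR)%:F =
        - (r1 - y) * (r2 - y) * (r3 - y) * (1 - r1 * r2 * r3 * y)
          / (Delta * K x y),
      (gser2 F N CQ)%:F =
        - (r1 - y) * (r2 - y) * (r3 - y) / (Delta * K x y)
          * (1 + 2^-1 * ((r1 + r2) ^+ 2 + (r1 + r3) ^+ 2 + (r2 + r3) ^+ 2)
             + (r1 + r2 + r3
                + r1 * r2 * r3 * (r1 * r2 + r1 * r3 + r2 * r3 - 1)) * y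
             + Delta * y ^+ 2),
      inj (gser1 F N (CQR^~ 0%N)) = r1 * r2 * r3 / (x * Delta)
    & inj (gser1 F N (CQ^~ 0%N)) =
        r1 * r2 * r3
          * (1 + 2^-1 * ((r1 + r2) ^+ 2 + (r1 + r3) ^+ 2 + (r2 + r3) ^+ 2))
          / (x * Delta)].
Proof.
move=> N_gt0 s_uniq s1_root s2_root s3_root inj x y r1 r2 r3 Delta.
have x0 : x != 0 by rewrite fracC_eq0 expf_neq0 ?fpsX_neq0.
have K0 : K x y != 0 := K_fracC_neq0 F N.
have Delta0 : Delta != 0 := Delta_fracC_neq0 s2 s3 s1_root.2.
have two0 : 2 != 0 :> {fraction {fps {fps F}}}.
  rewrite -(rmorph_nat (fracC _)) fracC_eq0 -(rmorph_nat (@fpsC _)) fpsC_eq0.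
  by rewrite pnatr_eq0.
have series b := nqpath_series N_gt0 s_uniq s1_root s2_root s3_root b.
rewrite CQE CQRE; split.
- exact: (restricted_gfE Delta0 K0 (series true).2).
- exact: (unrestricted_gfE Delta0 two0 K0 (series false).2).
- exact: (restricted_rowE Delta0 x0 (series true).1).
exact: (unrestricted_rowE Delta0 two0 x0 (series false).1).
Qed.
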